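(* Let $m>0$, let $(\eta,u)$ be a non-breaking solution of the dimensionless shallow water equations in the power-shaped bay with parameter $m$, and let $\psi(\sigma,\tau)$ (pressure) and $\varphi(\sigma,\tau)$ (velocity) be the functions associated with $(\eta,u)$ by the Carrier–Greenspan transformation. Then at the shoreline $\sigma=0$ they are related by $$\varphi(0,\tau)=-\partial_\tau\psi(0,\tau)$$ for all $\tau$ for which $(0,\tau)$ lies in the domain of $\psi$ and $\varphi$.
   Context: The dimensionless 1D shallow water equations in an inclined power-shaped bay $z(x,y)=-x+|y|^m$ with bay parameter $m>0$ are $$\partial_t\eta+u\,\partial_x(x+\eta)+\tfrac{m}{m+1}(x+\eta)\,\partial_x u=0,\qquad \partial_t u+u\,\partial_x u+\partial_x\eta=0,$$ where $\eta(x,t)$ is the water displacement and $u(x,t)$ the cross-section averaged velocity, considered on the wet region $x+\eta(x,t)\ge 0$; the shoreline is the free boundary $x+\eta(x,t)=0$. The Carrier–Greenspan transformation (CGT) introduces new independent variables and new unknowns by $$\sigma=x+\eta(x,t),\quad \tau=t-u(x,t),\quad \varphi(\sigma,\tau)=u(x,t),\quad \psi(\sigma,\tau)=\eta(x,t)+\tfrac12u(x,t)^2 .$$ ''Non-breaking'' means that the CGT is invertible, i.e. $(x,t)\mapsto(\sigma,\tau)$ is one-to-one with non-vanishing Jacobians $\det\frac{\partial(\sigma,\tau)}{\partial(x,t)}$ and $\det\frac{\partial(x,t)}{\partial(\sigma,\tau)}$, so that $\psi,\varphi$ are well-defined functions of $(\sigma,\tau)$. The shoreline corresponds to $\sigma=0$.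 Under the CGT the shallow water equations become the linear hyperbolic system $$\partial_\tau\psi+\tfrac{m}{m+1}\,\sigma\,\partial_\sigma\varphi+\varphi=0,\qquad \partial_\tau\varphi+\partial_\sigma\psi=0 ,\qquad \sigma\ge0.$$ Solutions are assumed smooth (up to and including the shoreline $\sigma=0$). *)

(* Defs.v *)
From Stdlib Require Import Reals.
From Coquelicot Require Import Coquelicot.
Open Scope R_scope.

Definition partial1 (f : R -> R -> R) (x y : R) : R := Derive (fun z => f z y) x.
Definition partial2 (f : R -> R -> R) (x y : R) : R := Derive (fun z => f x z) y.

(* det d(f,g)/d(x,y) *)
Definition jacobian (f g : R -> R -> R) (x y : R) : R :=
  partial1 f x y * partial2 g x y - partial2 f x y * partial1 g x y.

Definition open_2d (O : R -> R -> Prop) : Prop :=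
  forall x y, O x y -> locally_2d O x y.

Definition C1_on (O : R -> R -> Prop) (f : R -> R -> R) : Prop :=
  forall x y, O x y -> ex_diff_n f 1 x y.

(* Smoothness up to and including the free boundary means that eta and u are
   restrictions to the wet region of functions regular on an open set Omega of
   the (x,t)-plane.  Nothing but regularity is asked at points of Omega where
   x + eta < 0. *)
Definition wet (Omega : R -> R -> Prop) (eta : R -> R -> R) (x t : R) : Prop :=
  Omega x t /\ 0 <= x + eta x t.

Record swe_solution (m : R) (Omega : R -> R -> Prop) (eta u : R -> R -> R)
    : Prop := {
  swe_open : open_2d Omega;
  swe_eta_C1 : C1_on Omega eta;
  swe_u_C1 : C1_on Omega u;
  swe_mass : forall x t, wet Omega eta x t ->
    partial2 eta x t + u x t * partial1 (fun y s => y + eta y s) x t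
      + m / (m + 1) * (x + eta x t) * partial1 u x t = 0;
  swe_momentum : forall x t, wet Omega eta x t ->
    partial2 u x t + u x t * partial1 u x t + partial1 eta x t = 0
}.

Definition cg_sigma (eta : R -> R -> R) (x t : R) : R := x + eta x t.
Definition cg_tau (u : R -> R -> R) (x t : R) : R := t - u x t.

(* The image of the wet region, i.e. the common domain of psi and phi. *)
Definition cg_domain (Omega : R -> R -> Prop) (eta u : R -> R -> R)
    (sigma tau : R) : Prop :=
  exists x t, wet Omega eta x t /\ cg_sigma eta x t = sigma /\ cg_tau u x t = tau.

(* The inverse (X,T) is regular up to sigma = 0 in the same sense as above: it
   extends to an open set O containing the image.  Its derivatives on the image
   do not depend on the extension. *)
Record non_breaking (Omega : R -> R -> Prop) (eta u : R -> R -> R) : Prop := {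
  nb_injective : forall x1 t1 x2 t2,
    wet Omega eta x1 t1 -> wet Omega eta x2 t2 ->
    cg_sigma eta x1 t1 = cg_sigma eta x2 t2 ->
    cg_tau u x1 t1 = cg_tau u x2 t2 ->
    x1 = x2 /\ t1 = t2;
  nb_jacobian : forall x t, wet Omega eta x t ->
    jacobian (cg_sigma eta) (cg_tau u) x t <> 0;
  nb_inverse : exists (O : R -> R -> Prop) (X T : R -> R -> R),
    open_2d O /\
    (forall sigma tau, cg_domain Omega eta u sigma tau -> O sigma tau) /\
    C1_on O X /\ C1_on O T /\
    (forall x t, wet Omega eta x t ->
       X (cg_sigma eta x t) (cg_tau u x t) = x /\
       T (cg_sigma eta x t) (cg_tau u x t) = t) /\
    (forall sigma tau, cg_domain Omega eta u sigma tau ->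
       jacobian X T sigma tau <> 0)
}.

(* Determines psi and phi on cg_domain only; their values elsewhere are
   arbitrary. *)
Definition cg_transform (Omega : R -> R -> Prop) (eta u psi phi : R -> R -> R)
    : Prop :=
  forall x t, wet Omega eta x t ->
    phi (cg_sigma eta x t) (cg_tau u x t) = u x t /\
    psi (cg_sigma eta x t) (cg_tau u x t) = eta x t + / 2 * (u x t) ^ 2.

(* Main.v *)
Require Import Defs.
From Stdlib Require Import Reals Ranalysis5 Lra IndefiniteDescription.
From Coquelicot Require Import Coquelicot.
Open Scope R_scope.

(** Along the shoreline curve [x = b(t)], i.e. [b t + eta (b t) t = 0], the mass
    equation reads [b' = u], and the two equations together turn the Jacobian of
    the Carrier-Greenspan map into [(1 + eta_x)^2], which is therefore nonzero.
    By the momentum equation [tau = t - u] has derivative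
    [1 - u_t - u u_x = 1 + eta_x <> 0] along the curve, so it parametrises a
    neighbourhood of [tau] on [sigma = 0].  There [psi = - b + u^2 / 2], whose
    derivative is [- u + u (u_t + u u_x) = - u (1 + eta_x)]; dividing gives
    [- u]. *)

(** * Implicit functions of one variable *)

(** Since [F] is constant along the curve, an increment [h] of [t] and the increment [B] of [b]
    satisfy [|c B + k h| <= e max(|B|, |h|)]. Part of the right side is absorbed to get
    [|B| <= M |h|]; dividing by [c h] then gives the slope. Continuity of [b] keeps [B] where this
    estimate holds. *)
Lemma implicit_derive (F : R -> R -> R) (b : R -> R) (t c k : R) :
  differentiable_pt_lim F (b t) t c k -> c <> 0 -> continuity_pt b t ->
  locally t (fun s => F (b s) s = F (b t) t) ->
  is_derive b t (- k / c).
Proof.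
intros HF Hc Hb [d1 H1].
apply is_derive_Reals; intros eps Heps.
assert (Hc' : 0 < Rabs c) by (apply Rabs_pos_lt; exact Hc).
(* The value comes from solving [|c| |B| <= |k| |h| + |c|/2 (|B| + |h|)] for [|B|]. *)
set (M := 1 + 2 * Rabs k / Rabs c).
assert (HM : 1 <= M).
{ unfold M; assert (0 <= 2 * Rabs k / Rabs c); [|lra].
  apply Rdiv_le_0_compat; [|exact Hc']; pose proof (Rabs_pos k); lra. }
assert (HMc : M * Rabs c = Rabs c + 2 * Rabs k) by (unfold M; field; lra).
(* The first bound allows the absorption of [|B|]; the second makes the final error [e M / |c|] at
   most [eps / 2]. *)
set (e := Rmin (Rabs c / 2) (eps * Rabs c / (2 * M))).
assert (He : 0 < e).
{ apply Rmin_pos; [lra|]; apply Rdiv_lt_0_compat; [|lra].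
  apply Rmult_lt_0_compat; assumption. }
assert (He1 : e <= Rabs c / 2) by apply Rmin_l.
assert (He2 : e * M <= eps * Rabs c / 2).
{ apply Rle_trans with (eps * Rabs c / (2 * M) * M).
  - apply Rmult_le_compat_r; [lra|apply Rmin_r].
  - right; field; lra. }
destruct (HF (mkposreal e He)) as [d2 H2]; simpl in H2.
destruct (Hb d2 (cond_pos d2)) as [d3 [Hd3 H3]].
assert (Hd : 0 < Rmin d1 (Rmin d2 d3))
  by (apply Rmin_pos; [apply cond_pos|apply Rmin_pos; [apply cond_pos|exact Hd3]]).
exists (mkposreal _ Hd); simpl; intros h Hh Hhd.
assert (Hh1 : Rabs h < d1) by (eapply Rlt_le_trans; [exact Hhd|apply Rmin_l]).
assert (Hh2 : Rabs h < d2)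
  by (eapply Rlt_le_trans; [exact Hhd|eapply Rle_trans; [apply Rmin_r|apply Rmin_l]]).
assert (Hh3 : Rabs h < d3)
  by (eapply Rlt_le_trans; [exact Hhd|eapply Rle_trans; [apply Rmin_r|apply Rmin_r]]).
assert (Eh : t + h - t = h) by ring.
assert (HB : Rabs (b (t + h) - b t) < d2).
{ apply (H3 (t + h)); split.
  - split; [exact I|]; intro E; apply Hh; lra.
  - simpl; unfold R_dist; rewrite Eh; exact Hh3. }
assert (HFh : F (b (t + h)) (t + h) = F (b t) t).
{ apply H1; change (Rabs (t + h - t) < d1); rewrite Eh; exact Hh1. }
specialize (H2 (b (t + h)) (t + h) HB).
rewrite Eh, HFh in H2; specialize (H2 Hh2).
set (B := b (t + h) - b t) in *.
replace (F (b t) t - F (b t) t - (c * B + k * h)) with (- (c * B + k * h)) in H2 by ring.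
rewrite Rabs_Ropp in H2.
assert (HBM : Rabs B <= M * Rabs h).
{ assert (T : Rabs c * Rabs B <= Rabs (c * B + k * h) + Rabs k * Rabs h).
  { rewrite <- !Rabs_mult.
    replace (c * B) with ((c * B + k * h) + - (k * h)) at 1 by ring.
    eapply Rle_trans; [apply Rabs_triang|]; rewrite Rabs_Ropp; lra. }
  assert (Hmax : Rmax (Rabs B) (Rabs h) <= Rabs B + Rabs h).
  { pose proof (Rabs_pos B); pose proof (Rabs_pos h); apply Rmax_lub; lra. }
  assert (T2 : e * Rmax (Rabs B) (Rabs h) <= Rabs c / 2 * (Rabs B + Rabs h)).
  { apply Rmult_le_compat; [lra| |exact He1|exact Hmax].
    eapply Rle_trans; [apply (Rabs_pos B)|apply Rmax_l]. }
  apply Rmult_le_reg_l with (Rabs c); [exact Hc'|].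
  replace (Rabs c * (M * Rabs h)) with (M * Rabs c * Rabs h) by ring.
  rewrite HMc; lra. }
assert (Hmax : Rmax (Rabs B) (Rabs h) <= M * Rabs h).
{ apply Rmax_lub; [exact HBM|]; rewrite <- (Rmult_1_l (Rabs h)) at 1.
  apply Rmult_le_compat_r; [apply Rabs_pos|exact HM]. }
assert (Hh' : 0 < Rabs h) by (apply Rabs_pos_lt; exact Hh).
replace (B / h - - k / c) with ((c * B + k * h) / (c * h)) by (field; split; assumption).
unfold Rdiv at 1; rewrite Rabs_mult, Rabs_inv, Rabs_mult.
apply Rmult_lt_reg_r with (Rabs c * Rabs h); [apply Rmult_lt_0_compat; assumption|].
rewrite Rmult_assoc, Rinv_l, Rmult_1_r
  by (apply Rgt_not_eq, Rmult_lt_0_compat; assumption).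
assert (e * Rmax (Rabs B) (Rabs h) <= e * M * Rabs h)
  by (rewrite Rmult_assoc; apply Rmult_le_compat_l; lra).
assert (e * M * Rabs h <= eps * Rabs c / 2 * Rabs h)
  by (apply Rmult_le_compat_r; lra).
assert (0 < eps * Rabs c * Rabs h)
  by (repeat apply Rmult_lt_0_compat; assumption).
lra.
Qed.

Lemma differentiable_pt_lim_continuity (F : R -> R -> R) (x y a b : R) :
  differentiable_pt_lim F x y a b -> continuity_2d_pt F x y.
Proof.
intro H; apply differentiable_continuity_pt; exists a, b; exact H.
Qed.

Lemma differentiable_pt_lim_partial1 (F : R -> R -> R) (x y a b : R) :
  differentiable_pt_lim F x y a b -> is_derive (fun z => F z y) x a.
Proof.
intro H; apply is_derive_Reals.
replace a with (a * 1 + b * 0) by ring.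
apply (derivable_pt_lim_comp_2d F (fun z => z) (fun _ => y)).
- exact H.
- apply derivable_pt_lim_id.
- apply derivable_pt_lim_const.
Qed.

Lemma continuity_2d_pt_lt_0 (F : R -> R -> R) (x y : R) :
  continuity_2d_pt F x y -> F x y < 0 -> locally_2d (fun u v => F u v < 0) x y.
Proof.
intros H Hn; assert (Hp : 0 < - F x y) by lra.
destruct (H (mkposreal _ Hp)) as [d Hd]; exists d; intros u v Hu Hv.
specialize (Hd u v Hu Hv); simpl in Hd; apply Rabs_def2 in Hd; lra.
Qed.

Lemma continuity_2d_pt_gt_0 (F : R -> R -> R) (x y : R) :
  continuity_2d_pt F x y -> 0 < F x y -> locally_2d (fun u v => 0 < F u v) x y.
Proof.
intros H Hp.
destruct (H (mkposreal _ Hp)) as [d Hd]; exists d; intros u v Hu Hv.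
specialize (Hd u v Hu Hv); simpl in Hd; apply Rabs_def2 in Hd; lra.
Qed.

(** On a box around the point [F] is strictly increasing in [x]. The intermediate value theorem
    gives a root for each [t] near [t0], monotonicity makes it unique and traps it between nearby
    sign changes, hence continuity, and [implicit_derive] gives the slope. *)
Lemma implicit_function_pos (F Fx Ft : R -> R -> R) (x0 t0 : R) :
  locally_2d (fun x t => differentiable_pt_lim F x t (Fx x t) (Ft x t) /\ 0 < Fx x t)
    x0 t0 ->
  F x0 t0 = 0 ->
  exists b : R -> R, b t0 = x0 /\
    locally t0 (fun t => F (b t) t = 0 /\ is_derive b t (- Ft (b t) t / Fx (b t) t)).
Proof.
intros [r Hr] H0.
assert (Hrp := cond_pos r).
assert (inc : forall t x y, Rabs (t - t0) < r -> x0 - r < x -> x < y -> y < x0 + r ->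
  F x t < F y t).
{ intros t x y Ht Hx Hxy Hy.
  assert (Hbox : forall z : R, Rbar_lt (x0 - r) z -> Rbar_lt z (x0 + r) -> Rabs (z - x0) < r).
  { simpl; intros z A B; apply Rabs_def1; lra. }
  apply (incr_function (fun z => F z t) (x0 - r) (x0 + r) (fun z => Fx z t));
    try assumption.
  - intros z A B; eapply differentiable_pt_lim_partial1, Hr; [apply Hbox|]; assumption.
  - intros z A B; apply Hr; [apply Hbox|]; assumption. }
assert (cont : forall x t, x0 - r < x < x0 + r -> Rabs (t - t0) < r -> continuity_2d_pt F x t).
{ intros x t Hx Ht; eapply differentiable_pt_lim_continuity, Hr; [|exact Ht].
  apply Rabs_def1; lra. }
(* The signs of [F] at distance [p] on both sides of a root persist for nearby times. With
   [p = r / 2] this yields existence of roots, with small [p] continuity of [b]. *)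
assert (bracket : forall x t p, F x t = 0 -> Rabs (t - t0) < r -> 0 < p ->
  x0 - r < x - p -> x + p < x0 + r ->
  exists d : posreal, forall s, Rabs (s - t) < d -> F (x - p) s < 0 < F (x + p) s).
{ intros x t p E Ht Hp A B.
  destruct (continuity_2d_pt_lt_0 F (x - p) t) as [d1 D1].
  { apply cont; [lra|exact Ht]. }
  { rewrite <- E; apply inc; try assumption; lra. }
  destruct (continuity_2d_pt_gt_0 F (x + p) t) as [d2 D2].
  { apply cont; [lra|exact Ht]. }
  { rewrite <- E; apply inc; try assumption; lra. }
  assert (Hd : 0 < Rmin d1 d2) by (apply Rmin_pos; apply cond_pos).
  exists (mkposreal _ Hd); simpl; intros s Hs; split.
  - apply D1; [|eapply Rlt_le_trans; [exact Hs|apply Rmin_l]].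
    rewrite Rminus_diag, Rabs_R0; apply cond_pos.
  - apply D2; [|eapply Rlt_le_trans; [exact Hs|apply Rmin_r]].
    rewrite Rminus_diag, Rabs_R0; apply cond_pos. }
assert (Ht0 : Rabs (t0 - t0) < r) by (rewrite Rminus_diag, Rabs_R0; exact Hrp).
destruct (bracket x0 t0 (r / 2) H0 Ht0) as [d Hd]; try lra.
(* The condition on [t] stands under the existential so that choice gives a total function; 0 is a
   dummy value for distant [t]. *)
assert (root : forall t, exists x, Rabs (t - t0) < Rmin d r ->
  x0 - r < x < x0 + r /\ F x t = 0).
{ intro t; destruct (Rlt_dec (Rabs (t - t0)) (Rmin d r)) as [Ht|Ht];
    [|exists 0; intro; contradiction].
  assert (Htd := Rlt_le_trans _ _ _ Ht (Rmin_l _ _)).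
  assert (Htr := Rlt_le_trans _ _ _ Ht (Rmin_r _ _)).
  destruct (Hd t Htd) as [Hm Hp].
  destruct (IVT_interv (fun x => F x t) (x0 - r / 2) (x0 + r / 2)) as [x [Hx E]];
    try lra; [|exists x; split; [lra|exact E]].
  intros a Ha; apply derivable_continuous_pt; exists (Fx a t).
  apply is_derive_Reals; eapply differentiable_pt_lim_partial1, Hr; [|exact Htr].
  apply Rabs_def1; lra. }
destruct (functional_choice _ root) as [b Hb].
assert (Hdr : 0 < Rmin d r) by (apply Rmin_pos; apply cond_pos).
(* The chosen root is arbitrary a priori; uniqueness in the box forces [b t0 = x0]. *)
assert (uniq : forall t x, Rabs (t - t0) < Rmin d r -> x0 - r < x < x0 + r ->
  F x t = 0 -> b t = x).
{ intros t x Ht Hx E; destruct (Hb t Ht) as [Hbt Eb].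
  assert (Htr := Rlt_le_trans _ _ _ Ht (Rmin_r _ _)).
  destruct (Rtotal_order (b t) x) as [L|[L|L]]; [|exact L|];
    apply (inc t) in L; try assumption; lra. }
exists b; split.
{ apply uniq; [rewrite Rminus_diag, Rabs_R0; exact Hdr|lra|exact H0]. }
exists (mkposreal _ Hdr); intros t Ht; change (Rabs (t - t0) < Rmin d r) in Ht.
destruct (Hb t Ht) as [Hbt Eb]; split; [exact Eb|].
assert (Htr := Rlt_le_trans _ _ _ Ht (Rmin_r _ _)).
destruct (Hr (b t) t) as [HF Hpos]; [apply Rabs_def1; lra|exact Htr|].
assert (near : exists q, 0 < q /\ forall s, Rabs (s - t) < q -> Rabs (s - t0) < Rmin d r).
{ exists (Rmin d r - Rabs (t - t0)); split; [lra|]; intros s Hs.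
  replace (s - t0) with ((s - t) + (t - t0)) by ring.
  eapply Rle_lt_trans; [apply Rabs_triang|lra]. }
destruct near as [q [Hq near]].
apply (implicit_derive F); [exact HF|lra| |].
- intros eps Heps.
  (* Small enough for the required accuracy and for [b t - p] and [b t + p] to stay inside the
     box. *)
  set (p := Rmin (eps / 2) (Rmin ((b t - (x0 - r)) / 2) ((x0 + r - b t) / 2))).
  assert (Hp : 0 < p) by (repeat apply Rmin_pos; lra).
  assert (Hp1 : p <= eps / 2) by apply Rmin_l.
  assert (Hp2 : p <= (b t - (x0 - r)) / 2) by (eapply Rle_trans; [apply Rmin_r|apply Rmin_l]).
  assert (Hp3 : p <= (x0 + r - b t) / 2) by (eapply Rle_trans; [apply Rmin_r|apply Rmin_r]).
  destruct (bracket (b t) t p Eb Htr) as [d' Hd']; try lra.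
  exists (Rmin q d'); split; [apply Rmin_pos; [exact Hq|apply cond_pos]|].
  intros s [_ Hs]; change (Rabs (s - t) < Rmin q d') in Hs.
  assert (Hs' := near s (Rlt_le_trans _ _ _ Hs (Rmin_l _ _))).
  destruct (Hb s Hs') as [Hbs Es].
  assert (Hsr := Rlt_le_trans _ _ _ Hs' (Rmin_r _ _)).
  destruct (Hd' s (Rlt_le_trans _ _ _ Hs (Rmin_r _ _))) as [Hm Hpl].
  change (Rabs (b s - b t) < eps).
  apply Rabs_def1; apply Rnot_le_lt; intro L.
  + assert (F (b t + p) s < F (b s) s) by (apply inc; try assumption; lra); lra.
  + assert (F (b s) s < F (b t - p) s) by (apply inc; try assumption; lra); lra.
- exists (mkposreal q Hq); intros s Hs; rewrite Eb; apply Hb, near; exact Hs.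
Qed.

Lemma differentiable_pt_lim_opp (F : R -> R -> R) (x y a b : R) :
  differentiable_pt_lim F x y a b ->
  differentiable_pt_lim (fun u v => - F u v) x y (- a) (- b).
Proof.
intros H eps; destruct (H eps) as [d Hd]; exists d; intros u v Hu Hv.
rewrite <- Rabs_Ropp.
replace (- _) with (F u v - F x y - (a * (u - x) + b * (v - y))) by ring.
apply Hd; assumption.
Qed.

(** Continuity preserves the sign of [Fx] near the point. If it is negative, [F] is replaced by
    [- F], which has the same zeros and the same slope. *)
Lemma implicit_function (F Fx Ft : R -> R -> R) (x0 t0 : R) :
  locally_2d (fun x t => differentiable_pt_lim F x t (Fx x t) (Ft x t)) x0 t0 ->
  continuity_2d_pt Fx x0 t0 -> Fx x0 t0 <> 0 -> F x0 t0 = 0 ->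
  exists b : R -> R, b t0 = x0 /\
    locally t0 (fun t => F (b t) t = 0 /\ is_derive b t (- Ft (b t) t / Fx (b t) t)).
Proof.
intros HF Hc Hn H0; destruct (Rdichotomy _ _ Hn) as [neg|pos].
- destruct (implicit_function_pos (fun x t => - F x t) (fun x t => - Fx x t)
    (fun x t => - Ft x t) x0 t0) as [b [Hb0 Hb]].
  + apply locally_2d_and.
    * revert HF; apply locally_2d_impl, locally_2d_forall.
      intros x t; apply differentiable_pt_lim_opp.
    * generalize (continuity_2d_pt_lt_0 _ _ _ Hc neg).
      apply locally_2d_impl, locally_2d_forall; intros; lra.
  + lra.
  + exists b; split; [exact Hb0|]; revert Hb; apply filter_imp.
    intros t [E D]; split; [lra|].
    replace (- Ft (b t) t / Fx (b t) t) with (- - Ft (b t) t / - Fx (b t) t); [exact D|].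
    unfold Rdiv; rewrite Rinv_opp; ring.
- apply implicit_function_pos; [|exact H0].
  apply locally_2d_and; [exact HF|]; apply continuity_2d_pt_gt_0; assumption.
Qed.

(* The implicit function of [g t - s = 0] is a local inverse of [g]. *)
Lemma is_derive_parametric (f g h g' : R -> R) (t0 k : R) :
  locally t0 (fun t => is_derive g t (g' t)) -> continuity_pt g' t0 -> g' t0 <> 0 ->
  is_derive h t0 k -> locally t0 (fun t => f (g t) = h t) ->
  is_derive f (g t0) (k / g' t0).
Proof.
intros Hg Hc Hn Hh Hf.
destruct (implicit_function (fun t s => g t - s) (fun t _ => g' t) (fun _ _ => -1) t0 (g t0))
  as [b [Hb0 Hb]].
- destruct Hg as [d Hd]; exists d; intros u v Hu _.
  assert (D := Hd u Hu); apply is_derive_Reals in D.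
  apply (differentiable_pt_lim_proj1_0 _ _ v) in D.
  intro eps; generalize (D eps); apply locally_2d_impl, locally_2d_forall.
  intros x y Hxy; eapply Rle_trans; [|exact Hxy]; right; f_equal; ring.
- apply (continuity_1d_2d_pt_comp g' (fun t _ => t));
    [exact Hc|apply continuity_2d_pt_id1].
- exact Hn.
- ring.
- assert (Hb1 : is_derive b (g t0) (/ g' t0)).
  { destruct (locally_singleton _ _ Hb) as [_ D]; rewrite Hb0 in D.
    replace (/ g' t0) with (- -1 / g' t0); [exact D|field; exact Hn]. }
  (* Near [g t0], [f s = f (g (b s)) = h (b s)]. Differentiability of [f] is thus a conclusion,
     obtained from that of [h] and [b]. *)
  apply is_derive_ext_loc with (fun s => h (b s)).
  + assert (Cb : continuous b (g t0))
      by (apply (@ex_derive_continuous R_AbsRing R_NormedModule); eexists; exact Hb1).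
    rewrite <- Hb0 in Hf; specialize (Cb _ Hf).
    generalize (filter_and _ _ Hb Cb); apply filter_imp.
    intros s [[E _] E']; simpl in E'; rewrite <- E'; f_equal; lra.
  + rewrite <- Hb0 in Hh.
    apply is_derive_Reals, (derivable_pt_lim_comp b h); apply is_derive_Reals; assumption.
Qed.

(** * Regular functions of two variables along curves *)

(** Total differentiability follows from both partial derivatives existing, the first one in a whole
    neighbourhood, supplied by openness, and being continuous at the point. *)
Lemma C1_on_differentiable (O : R -> R -> Prop) (f : R -> R -> R) (x y : R) :
  open_2d O -> C1_on O f -> O x y ->
  differentiable_pt_lim f x y (partial1 f x y) (partial2 f x y).
Proof.
intros Ho Hf Hxy; apply filterdiff_differentiable_pt_lim.
apply (is_derive_filterdiff f x y (partial1 f) (partial2 f x y)).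
- apply (proj1 (locally_2d_locally
    (fun v w => is_derive (fun z => f z w) v (partial1 f v w)) x y)).
  generalize (Ho x y Hxy); apply locally_2d_impl, locally_2d_forall.
  intros u v Huv; apply Derive_correct; apply (Hf u v Huv).
- apply Derive_correct; apply (Hf x y Hxy).
- apply continuity_2d_pt_filterlim; apply (Hf x y Hxy).
Qed.

Lemma C1_on_derive_curve (O : R -> R -> Prop) (f : R -> R -> R) (b : R -> R) (t l : R) :
  open_2d O -> C1_on O f -> O (b t) t -> is_derive b t l ->
  is_derive (fun s => f (b s) s) t (partial1 f (b t) t * l + partial2 f (b t) t).
Proof.
intros Ho Hf Ht Hb; apply is_derive_Reals.
rewrite <- (Rmult_1_r (partial2 f (b t) t)).
apply (derivable_pt_lim_comp_2d f b (fun s => s)).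
- apply (C1_on_differentiable O); assumption.
- apply is_derive_Reals; exact Hb.
- apply derivable_pt_lim_id.
Qed.

Lemma continuity_pt_curve (f : R -> R -> R) (b : R -> R) (t : R) :
  continuity_2d_pt f (b t) t -> continuity_pt b t -> continuity_pt (fun s => f (b s) s) t.
Proof.
intros Hf Hb.
apply continuity_pt_filterlim; intros P [e He].
destruct (Hf e) as [d Hd].
assert (Hd' : locally (b t) (fun y => Rabs (y - b t) < d)) by (exists d; intros y Hy; exact Hy).
apply continuity_pt_filterlim in Hb; specialize (Hb _ Hd'); unfold filtermap in Hb.
assert (Ht : locally t (fun y => Rabs (y - t) < d)) by (exists d; intros y Hy; exact Hy).
refine (filter_imp _ _ _ (filter_and _ _ Hb Ht)).
intros s [H1 H2]; apply He, Hd; assumption.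
Qed.

(** * The Carrier-Greenspan map at the shoreline *)

Lemma cg_sigma_differentiable (Omega : R -> R -> Prop) (eta : R -> R -> R) (x t : R) :
  open_2d Omega -> C1_on Omega eta -> Omega x t ->
  differentiable_pt_lim (cg_sigma eta) x t (1 + partial1 eta x t) (partial2 eta x t).
Proof.
intros Ho He Hx eps.
generalize (C1_on_differentiable _ _ _ _ Ho He Hx eps).
apply locally_2d_impl, locally_2d_forall; intros u v H.
eapply Rle_trans; [|exact H]; right; f_equal; unfold cg_sigma; ring.
Qed.

Lemma cg_tau_differentiable (Omega : R -> R -> Prop) (u : R -> R -> R) (x t : R) :
  open_2d Omega -> C1_on Omega u -> Omega x t ->
  differentiable_pt_lim (cg_tau u) x t (- partial1 u x t) (1 - partial2 u x t).
Proof.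
intros Ho He Hx eps.
generalize (C1_on_differentiable _ _ _ _ Ho He Hx eps).
apply locally_2d_impl, locally_2d_forall; intros y v H.
eapply Rle_trans; [|exact H]; right; rewrite <- Rabs_Ropp; f_equal; unfold cg_tau; ring.
Qed.

(** The term with factor [m / (m + 1)] carries [x + eta = 0]. What remains is the kinematic
    condition: the shoreline moves with the fluid. *)
Lemma swe_shoreline_mass (m : R) (Omega : R -> R -> Prop) (eta u : R -> R -> R) (x t : R) :
  swe_solution m Omega eta u -> Omega x t -> cg_sigma eta x t = 0 ->
  partial2 eta x t = - u x t * (1 + partial1 eta x t).
Proof.
intros H Hx H0; assert (Hw : wet Omega eta x t)
  by (split; [exact Hx|unfold cg_sigma in H0; lra]).
assert (E := swe_mass _ _ _ _ H x t Hw).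
unfold cg_sigma in H0; rewrite H0 in E.
destruct (differentiable_pt_lim_unique _ _ _ _ _
  (cg_sigma_differentiable _ _ _ _ (swe_open _ _ _ _ H) (swe_eta_C1 _ _ _ _ H) Hx)) as [D _].
change (partial1 (fun y s => y + eta y s) x t = 1 + partial1 eta x t) in D.
rewrite D in E; lra.
Qed.

(** The mass equation makes [1 + eta_x] a common factor of [sigma_x] and [sigma_t]; the cofactor
    [1 - u_t - u u_x] is again [1 + eta_x] by momentum. *)
Lemma jacobian_shoreline (m : R) (Omega : R -> R -> Prop) (eta u : R -> R -> R) (x t : R) :
  swe_solution m Omega eta u -> Omega x t -> cg_sigma eta x t = 0 ->
  jacobian (cg_sigma eta) (cg_tau u) x t = (1 + partial1 eta x t) ^ 2.
Proof.
intros H Hx H0; assert (Hw : wet Omega eta x t)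
  by (split; [exact Hx|unfold cg_sigma in H0; lra]).
assert (E := swe_momentum _ _ _ _ H x t Hw).
assert (Em := swe_shoreline_mass _ _ _ _ _ _ H Hx H0).
assert (Ho := swe_open _ _ _ _ H).
destruct (differentiable_pt_lim_unique _ _ _ _ _
  (cg_sigma_differentiable _ _ _ _ Ho (swe_eta_C1 _ _ _ _ H) Hx)) as [D1 D2].
destruct (differentiable_pt_lim_unique _ _ _ _ _
  (cg_tau_differentiable _ _ _ _ Ho (swe_u_C1 _ _ _ _ H) Hx)) as [D3 D4].
unfold jacobian; unfold partial1 at 1 2; unfold partial2 at 1 2.
rewrite D1, D2, D3, D4, Em.
replace (partial2 u x t) with (- u x t * partial1 u x t - partial1 eta x t) by lra.
ring.
Qed.

(** * Differentiating the pressure along the shoreline *)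

Theorem proposition1 (m : R) (Omega : R -> R -> Prop) (eta u psi phi : R -> R -> R)
    (hm : 0 < m)
    (hsol : swe_solution m Omega eta u)
    (hnb : non_breaking Omega eta u)
    (hcg : cg_transform Omega eta u psi phi)
    (tau : R) (htau : cg_domain Omega eta u 0 tau) :
  ex_derive (fun s => psi 0 s) tau /\ phi 0 tau = - partial2 psi 0 tau.
Proof.
destruct htau as [x0 [t0 [Hw [Hs Ht]]]].
assert (Ho := swe_open _ _ _ _ hsol).
assert (He := swe_eta_C1 _ _ _ _ hsol).
assert (Hu := swe_u_C1 _ _ _ _ hsol).
assert (HO : Omega x0 t0) by apply Hw.
(* Non-breaking becomes the condition under which [sigma = 0] is locally a graph over [t]. *)
assert (Hn : 1 + partial1 eta x0 t0 <> 0).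
{ intro E; apply (nb_jacobian _ _ _ hnb x0 t0 Hw).
  rewrite (jacobian_shoreline m Omega eta u x0 t0 hsol HO Hs), E; ring. }
assert (Ce : continuity_2d_pt (fun x t => 1 + partial1 eta x t) x0 t0).
{ apply (continuity_2d_pt_plus (fun _ _ => 1)); [apply continuity_2d_pt_const|].
  apply (He x0 t0 HO). }
destruct (implicit_function (cg_sigma eta) (fun x t => 1 + partial1 eta x t)
  (partial2 eta) x0 t0) as [b [Hb0 Hb]]; try assumption.
{ generalize (Ho x0 t0 HO); apply locally_2d_impl, locally_2d_forall.
  intros x t; apply cg_sigma_differentiable; assumption. }
assert (Cb : continuity_pt b t0).
{ destruct (locally_singleton _ _ Hb) as [_ D].
  apply continuity_pt_filterlim, (@ex_derive_continuous R_AbsRing R_NormedModule).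
  eexists; exact D. }
assert (Cn : continuity_pt (fun t => 1 + partial1 eta (b t) t) t0).
{ apply (continuity_pt_curve (fun x t => 1 + partial1 eta x t)); [|exact Cb].
  rewrite Hb0; exact Ce. }
(* Membership in [Omega] and [1 + eta_x <> 0] are known at one point only; continuity spreads them
   along the curve, where the equations are then applied. *)
assert (HbO : locally t0 (fun t => Omega (b t) t /\ 1 + partial1 eta (b t) t <> 0)).
{ apply filter_and.
  - destruct (Ho x0 t0 HO) as [d Hd]; apply continuity_pt_filterlim in Cb.
    assert (L : locally (b t0) (fun x => Rabs (x - x0) < d))
      by (rewrite Hb0; exists d; intros y Hy; exact Hy).
    specialize (Cb _ L); unfold filtermap in Cb.
    assert (L' : locally t0 (fun t => Rabs (t - t0) < d)) by (exists d; intros y Hy; exact Hy).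
    refine (filter_imp _ _ _ (filter_and _ _ Cb L')).
    intros t [A B]; apply Hd; assumption.
  - apply continuity_pt_filterlim in Cn; apply (Cn (fun y => y <> 0)).
    rewrite Hb0; apply open_neq; exact Hn. }
assert (shore : locally t0 (fun t => Omega (b t) t /\ cg_sigma eta (b t) t = 0 /\
  is_derive b t (u (b t) t) /\
  is_derive (fun s => cg_tau u (b s) s) t (1 + partial1 eta (b t) t) /\
  is_derive (fun s => u (b s) s) t (- partial1 eta (b t) t))).
{ generalize (filter_and _ _ Hb HbO); apply filter_imp; clear - hsol Ho Hu.
  intros t [[E D] [HO Hn]].
  rewrite (swe_shoreline_mass _ _ _ _ _ _ hsol HO E) in D.
  (* The implicit slope [- eta_t / (1 + eta_x)] simplifies to [u]. *)
  replace (- (- u (b t) t * _) / _) with (u (b t) t) in D by (field; exact Hn).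
  assert (Em := swe_momentum _ _ _ _ hsol (b t) t).
  assert (Hw : wet Omega eta (b t) t) by (split; [exact HO|unfold cg_sigma in E; lra]).
  specialize (Em Hw).
  assert (Du := C1_on_derive_curve Omega u b t _ Ho Hu HO D).
  (* With [b' = u], the derivative of [u] along the curve is [u_t + u u_x], which momentum
     identifies with [- eta_x]. *)
  replace (_ + _) with (- partial1 eta (b t) t) in Du by lra.
  refine (conj HO (conj E (conj D (conj _ Du)))).
  apply is_derive_Reals; replace (1 + _) with (1 - - partial1 eta (b t) t) by ring.
  apply (derivable_pt_lim_minus id (fun s => u (b s) s)).
  - apply derivable_pt_lim_id.
  - apply is_derive_Reals; exact Du. }
assert (Dpsi : is_derive (fun s => psi 0 s) tau (- u x0 t0)).
{ destruct (locally_singleton _ _ shore) as [_ [_ [D [_ Du]]]]; rewrite Hb0 in D, Du.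
  replace tau with (cg_tau u (b t0) t0) by (rewrite Hb0; exact Ht).
  (* Rewritten as the quotient of the derivatives of [psi] and of [tau] along the curve. *)
  replace (- u x0 t0)
    with (- u x0 t0 * (1 + partial1 eta x0 t0) / (1 + partial1 eta (b t0) t0))
    by (rewrite Hb0; field; exact Hn).
  apply (is_derive_parametric (fun s => psi 0 s) (fun t => cg_tau u (b t) t)
    (fun t => - b t + / 2 * (u (b t) t) ^ 2) (fun t => 1 + partial1 eta (b t) t)).
  - revert shore; apply filter_imp; intros t Q; apply Q.
  - exact Cn.
  - rewrite Hb0; exact Hn.
  - replace (- u x0 t0 * (1 + partial1 eta x0 t0))
      with (- u x0 t0 + / 2 * (INR 2 * - partial1 eta x0 t0 * u (b t0) t0 ^ Nat.pred 2))
      by (rewrite Hb0; simpl; field).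
    apply (is_derive_plus (fun t => - b t)).
    + apply (is_derive_opp b); exact D.
    + apply (is_derive_scal (fun t => u (b t) t ^ 2)).
      apply (is_derive_pow (fun t => u (b t) t)); exact Du.
  (* Shoreline points count as wet, so the transform applies there, and [eta = - b] turns [psi] into
     [- b + u^2 / 2]. *)
  - revert shore; apply filter_imp; intros t [HOt [E _]].
    assert (Hwt : wet Omega eta (b t) t) by (split; [exact HOt|unfold cg_sigma in E; lra]).
    destruct (hcg _ _ Hwt) as [_ Q]; rewrite E in Q; rewrite Q.
    unfold cg_sigma in E; lra. }
split; [eexists; exact Dpsi|].
(* [partial2] is a total derivative operator; [Dpsi] supplies its actual value. *)
replace (partial2 psi 0 tau) with (- u x0 t0)
  by (symmetry; exact (is_derive_unique _ _ _ Dpsi)).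
destruct (hcg _ _ Hw) as [Q _]; rewrite Hs, Ht in Q; rewrite Q; ring.
Qed.
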